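(* Let $G=(V,E)$ be a finite simple undirected $k$-regular graph whose adjacency matrix $A$ belongs to an association scheme, and let $\lambda_{\min}(A)$ be the smallest eigenvalue of $A$. Then $$\eta^\circ(G)=\frac{2k}{k-\lambda_{\min}(A)}.$$ In particular, $$1\le \frac{\mathrm{fcc}(G)}{\frac{2k}{k-\lambda_{\min}(A)}}\le \frac{1}{\alpha_{\mathrm{GW}}}.$$
   Context: Let $G=(V,E)$ be a finite simple undirected loopless graph. For real symmetric matrices, $N\succcurlyeq 0$ means positive semidefinite; $\mathrm{diag}(N)$ is the vector of diagonal entries; $\mathbb{1}$ is the all-ones vector. For a symmetric matrix $N$ indexed by $V$, $\mathcal{L}^*(N)\in\mathbb{R}^E$ is defined by $\mathcal{L}^*(N)_{ij}=N_{ii}+N_{jj}-2N_{ij}$ for $ij\in E$. Define $$\eta^\circ(G)=\min\{\mu : \mu\ge 0,\ N\succcurlyeq 0,\ \mathrm{diag}(N)=\mu\cdot\mathbb{1},\ \tfrac14\mathcal{L}^*(N)\ge\mathbb{1}\}.$$ The fractional cut-cover number is $$\mathrm{fcc}(G)=\min\Big\{\mathbb{1}^Ty : y\in\mathbb{R}^{\mathcal{P}(V)}_+,\ \sum_{S\subseteq V}y_S\cdot\mathbb{1}_{\delta(S)}\ge\mathbb{1}\Big\},$$ where $\mathcal{P}(V)$ is the power set of $V$, $\delta(S)$ is the set of edges with one end in $S$ and the other in $V\setminus S$, and $\mathbb{1}_{\delta(S)}\in\{0,1\}^E$ is its indicator vector. The Goemans–Williamson constant is $\alpha_{\mathrm{GW}}=\min_{0<\theta\le\pi}\frac{2}{\pi}\frac{\theta}{1-\cos\theta}\approx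 0.878$. An association scheme is a set $\{A_0,\dots,A_d\}$ of nonzero symmetric square matrices with entries in $\{0,1\}$ such that: (1) $\sum_iA_i=J$, the all-ones matrix; (2) any $A_i$ with a nonzero diagonal entry is a diagonal matrix; (3) there are nonnegative integers $p_{ij}^l$ with $A_iA_j=\sum_{l=0}^d p_{ij}^lA_l$ for all $i,j$. (These conditions imply that the matrices commute and that the identity matrix $I$ is one of them.) *)

(* Defs.v *)
From HB Require Import structures.
From mathcomp Require Import all_boot all_order all_algebra.
From mathcomp Require Import all_classical all_reals all_analysis.

Set Implicit Arguments.
Unset Strict Implicit.
Unset Printing Implicit Defensive.

Import Order.TTheory GRing.Theory Num.Theory.

Local Open Scope classical_set_scope.
Local Open Scope ring_scope.

Definition is_min (R : realType) (A : set R) (m : R) : Prop :=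
  A m /\ lbound A m.

(* [set_min A] is the least element of [A], and the junk value 0 when [A] has
   no least element (so it differs from [inf A] when the infimum is not
   attained). *)
Definition set_min (R : realType) (A : set R) : R := xget 0 (is_min A).

Lemma set_min_eq (R : realType) (A : set R) (m : R) :
  is_min A m -> set_min A = m.
Proof.
move=> [Am lm]; apply: xget_unique; first by split.
by move=> x [Ax lx]; apply/le_anti; rewrite lx // lm.
Qed.

Record sgraph (V : finType) := SGraph {
  adj :> rel V;
  adj_sym : symmetric adj;
  adj_irr : irreflexive adj }.

Definition regular (V : finType) (G : sgraph V) (k : nat) : Prop :=
  forall u : V, #|[set v | G u v]%SET| = k.

(* A matrix indexed by [V] is a matrix of order [#|V|], through the bijection
   [enum_rank : V -> 'I_#|V|] and its inverse [enum_val]. *)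
Definition adjmx (R : realType) (V : finType) (G : sgraph V) : 'M[R]_#|V| :=
  \matrix_(i, j) (G (enum_val i) (enum_val j))%:R.

Definition psdmx (R : realType) (n : nat) (N : 'M[R]_n) : Prop :=
  N^T = N /\ forall x : 'cV[R]_n, 0 <= (x^T *m N *m x) 0 0.

Definition Lstar (R : realType) (V : finType) (N : 'M[R]_#|V|) (u v : V) : R :=
  N (enum_rank u) (enum_rank u) + N (enum_rank v) (enum_rank v)
  - 2 * N (enum_rank u) (enum_rank v).

(* Here and in [fcc_feasible] the constraint of an edge uv is imposed for both
   ordered pairs (u, v) and (v, u); the two instances are equivalent. *)
Definition eta_feasible (R : realType) (V : finType) (G : sgraph V)
    (mu : R) (N : 'M[R]_#|V|) : Prop :=
  [/\ 0 <= mu, psdmx N, (forall i, N i i = mu)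
    & forall u v : V, G u v -> 1 <= 4^-1 * Lstar N u v].

Definition eta_circ (R : realType) (V : finType) (G : sgraph V) : R :=
  set_min [set mu : R | exists N : 'M[R]_#|V|, eta_feasible G mu N].

(* Value at the edge uv of the indicator vector of the cut delta(S). *)
Definition cut_ind (R : realType) (V : finType) (S : {set V}) (u v : V) : R :=
  ((u \in S) != (v \in S))%:R.

Definition fcc_feasible (R : realType) (V : finType) (G : sgraph V)
    (y : {set V} -> R) : Prop :=
  (forall S : {set V}, 0 <= y S) /\
  (forall u v : V, G u v -> 1 <= \sum_(S : {set V}) y S * cut_ind R S u v).

Definition fcc (R : realType) (V : finType) (G : sgraph V) : R :=
  set_min [set \sum_(S : {set V}) y S | y in [set y : {set V} -> R |
                                               fcc_feasible G y]].

Definition alphaGW (R : realType) : R :=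
  set_min [set 2 / pi * (t / (1 - cos t)) | t in [set t : R | 0 < t <= pi]].

Definition lambda_min (R : realType) (n : nat) (A : 'M[R]_n) : R :=
  set_min [set a : R | eigenvalue A a].

(* The matrices form an indexed family; the conditions force them to be
   pairwise distinct, so the family is the same data as the set. *)
Definition assoc_scheme (R : realType) (n d : nat) (S : 'I_d.+1 -> 'M[R]_n)
    : Prop :=
  [/\ forall i, [/\ S i != 0, (S i)^T = S i
                  & forall x y, S i x y = 0 \/ S i x y = 1],
      \sum_i S i = const_mx 1,
      forall i, (exists x, S i x x != 0) -> is_diag_mx (S i)
    & exists p : 'I_d.+1 -> 'I_d.+1 -> 'I_d.+1 -> nat,
        forall i j, S i *m S j = \sum_l (p i j l)%:R *: S l].

(* Main.v *)
Require Import Defs.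
From HB Require Import structures.
From mathcomp Require Import all_boot all_order all_algebra.
From mathcomp Require Import all_classical all_reals all_analysis.
From mathcomp Require Import complex measurable_realfun ring lra.

Set Implicit Arguments.
Unset Strict Implicit.
Unset Printing Implicit Defensive.

Import Order.TTheory GRing.Theory Num.Theory.
Import numFieldNormedType.Exports.

Local Open Scope ring_scope.

(** Let [l] be the least eigenvalue of [A] and [P = p(A)], where [p] is the
    minimal polynomial of [A] divided by [X - l]. Then [A P = l P], and since
    [P P] lies in the algebra spanned by the scheme, its diagonal is constant
    and so are its entries at the edges; rescaled, it is feasible for [eta] with
    value [2k / (k - l)]. Conversely, summing the edge constraints of a feasible
    [N] and using [tr ((A - l I) N) >= 0] gives the matching lower bound.

    A fractional cut cover [y] yields the feasible matrix [sum_S y_S s s^T] with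
    [s] the sign vector of [S], so [eta <= fcc]. For the other bound, the rows
    of [P] are rounded by a random hyperplane. The normal of the hyperplane is
    uniform in the unit ball of [R^n], with [n]-fold product Lebesgue measure.
    This measure is invariant under plane rotations because these are products
    of shears. Hence the measure separating two unit vectors depends only on
    their angle, and additivity in the angle makes it at least proportional to
    the angle. *)

(** * Isometries of product Lebesgue measure *)

Section sfprod.
Local Open Scope classical_set_scope.
Local Open Scope ereal_scope.
Context d1 d2 (T1 : measurableType d1) (T2 : measurableType d2) (R : realType).
Variable m1 : {sigma_finite_measure set T1 -> \bar R}.
Variable m2 : {sigma_finite_measure set T2 -> \bar R}.

(* A copy of [m1 \x m2]: the canonical sigma-finite structure on [\x] only
   covers products of subprobabilities. *)
Definition sfprod : set (T1 * T2) -> \bar R := m1 \x m2.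
HB.instance Definition _ := Measure.copy sfprod (m1 \x m2).

Lemma sigma_finite_sfprod : sigma_finite setT sfprod.
Proof.
have /sigma_finiteP[F [TF ndF Foo]] := sigma_finiteT m1.
have /sigma_finiteP[G [TG ndG Goo]] := sigma_finiteT m2.
exists (fun n => F n `*` G n); last first.
  move=> k; have [mF Fk] := Foo k; have [mG Gk] := Goo k.
  split; first exact: measurableX.
  by rewrite /sfprod product_measure1E// lte_mul_pinfty// ge0_fin_numE.
rewrite -setXTT TF TG predeqE => -[x y]; split=> [[/= [n _ Fnx] [k _ Gky]]|].
  exists (maxn n k) => //; split.
  - by move: x Fnx; exact/subsetPset/ndF/leq_maxl.
  - by move: y Gky; exact/subsetPset/ndG/leq_maxr.
by move=> [n _ []/= ? ?]; split; exists n.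
Qed.

HB.instance Definition _ := Measure_isSigmaFinite.Build _ _ _ sfprod
  sigma_finite_sfprod.
End sfprod.

(** * Measure-preserving maps: translations and shears *)

Section measure_preserving.
Local Open Scope classical_set_scope.
Local Open Scope ereal_scope.
Context {R : realType}.

Definition preserving d (T : measurableType d) (m : set T -> \bar R)
    (f : T -> T) : Prop :=
  measurable_fun setT f /\ forall A, measurable A -> m (f @^-1` A) = m A.

Lemma preserving_id d (T : measurableType d) (m : set T -> \bar R) :
  preserving m id.
Proof. by split. Qed.

Lemma preserving_comp d (T : measurableType d) (m : set T -> \bar R) f g :
  preserving m f -> preserving m g -> preserving m (f \o g).
Proof.
move=> [mf pf] [mg pg]; split; first exact: measurableT_comp.
move=> A mA; rewrite comp_preimage pg ?pf//.
by rewrite -[X in measurable X]setTI; exact: mf.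
Qed.

(** The image measure gives each half-open interval its length, which characterizes Lebesgue
    measure. *)
Lemma lebesgue_measure_shift (a : R) (A : set (measurableTypeR R)) :
  measurable A ->
  lebesgue_measure ((fun x : measurableTypeR R => (x + a)%R) @^-1` A) =
    lebesgue_measure A.
Proof.
have mf : measurable_fun setT
    ((fun x => x + a)%R : measurableTypeR R -> measurableTypeR R).
  by apply: measurable_funD.
move=> mA; apply/esym.
pose f : {mfun measurableTypeR R >-> measurableTypeR R} :=
  @mfun_Sub _ _ (measurableTypeR R) (measurableTypeR R) _ (mem_set mf).
apply: (@lebesgue_measure_unique _ (pushforward lebesgue_measure f)) => // _ [[b c]] _ <-.
rewrite /= /pushforward/=.
rewrite [X in _ = _ X](_ : _ = `]b - a, c - a]%classic)%R.
  rewrite !lebesgue_measure_itv/= !lte_fin ltrD2r.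
  by case: ifP => // _; rewrite -!EFinB; congr (_%:E); ring.
by apply/seteqP; split=> x /=; rewrite !in_itv/= ltrBlDr lerBrDr.
Qed.

(** Fubini: the section at [x] of the preimage is the preimage under [g x] of the section, so the
    integrands agree. *)
Lemma preserving_fiberwise d1 d2 (T1 : measurableType d1) (T2 : measurableType d2)
    (m1 : {sigma_finite_measure set T1 -> \bar R})
    (m2 : {sigma_finite_measure set T2 -> \bar R}) (g : T1 -> T2 -> T2) :
  measurable_fun setT (fun p : T1 * T2 => (p.1, g p.1 p.2)) ->
  (forall x, preserving m2 (g x)) ->
  preserving (sfprod m1 m2) (fun p => (p.1, g p.1 p.2)).
Proof.
move=> mf pg; split=> // A mA; rewrite /sfprod /product_measure1.
apply: eq_integral => x _ /=.
rewrite -[in RHS](pg x).2; last exact: measurable_xsection.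
by congr (m2 _); apply/seteqP; split=> y /=; rewrite /xsection /= !inE.
Qed.

Lemma preserving_shear d (T : measurableType d)
    (m : {sigma_finite_measure set T -> \bar R}) (phi : T -> R) :
  measurable_fun setT phi ->
  preserving (sfprod (@lebesgue_measure R) m)
    (fun p : measurableTypeR R * T => (p.1 + phi p.2, p.2)%R).
Proof.
move=> mphi.
have mf : measurable_fun setT (fun p : measurableTypeR R * T =>
    ((p.1 + phi p.2)%R : measurableTypeR R, p.2)).
  apply: measurable_fun_pair => //.
  apply: measurable_funD => //; exact: measurableT_comp.
split=> // A mA; rewrite /sfprod.
(* The product measure is computed in the other order of integration, where the sections along the
   shifted coordinate are translates. *)
have E B : measurable B -> (lebesgue_measure \x m) B = (lebesgue_measure \x^ m) B.
  by move=> mB; apply: product_measure_unique => // *; exact: product_measure2E.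
rewrite !E//; last by rewrite -[X in measurable X]setTI; exact: mf.
apply: eq_integral => y _ /=.
rewrite -[in RHS](@lebesgue_measure_shift (phi y)); last exact: measurable_ysection.
by congr (lebesgue_measure _); apply/seteqP; split=> x /=; rewrite /ysection /= !inE.
Qed.

End measure_preserving.

(** * Euclidean space as an iterated product, and its rotations *)

Section euclid.
Variable R : realType.
Local Open Scope classical_set_scope.

(** The display of the product structure varies with [n], so it is packed together with the type. *)
Fixpoint euclid_space (n : nat) : {d & measurableType d} :=
  if n is n'.+1 then
    existT (fun d => measurableType d) _
      (measurableTypeR R * projT2 (euclid_space n'))%type
  else existT (fun d => measurableType d) _ unit.
Arguments euclid_space : simpl never.
Notation euclid n := (projT2 (euclid_space n)).

Fixpoint vol (n : nat) : {sigma_finite_measure set (euclid n) -> \bar R} :=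
  if n is n'.+1 return {sigma_finite_measure set (euclid n) -> \bar R}
  then sfprod (@lebesgue_measure R) (vol n')
  else @dirac _ unit tt R.

Fixpoint dot (n : nat) : euclid n -> euclid n -> R :=
  if n is n'.+1 return euclid n -> euclid n -> R
  then fun x y => x.1 * y.1 + dot x.2 y.2 else fun _ _ => 0.

Fixpoint vec (n : nat) (f : nat -> R) : euclid n :=
  if n is n'.+1 return euclid n then (f 0%N, vec n' (fun i => f i.+1)) else tt.

Notation vec0 n := (vec n (fun=> 0)).

Lemma dot_vec n f g : dot (vec n f) (vec n g) = \sum_(i < n) f i * g i.
Proof.
elim: n f g => [|n IH] f g; first by rewrite big_ord0.
by rewrite big_ord_recl /= IH.
Qed.

Lemma dot0v n x : dot (vec0 n) x = 0.
Proof. by elim: n x => //= n IH x; rewrite mul0r add0r IH. Qed.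

Lemma dot_ge0 n (x : euclid n) : 0 <= dot x x.
Proof. by elim: n x => //= n IH x; rewrite addr_ge0 // -expr2 sqr_ge0. Qed.

Lemma dot_eq0 n (x : euclid n) : dot x x = 0 -> x = vec0 n.
Proof.
elim: n x => [[]//|n IH] [a x] /= /eqP.
rewrite paddr_eq0 ?dot_ge0 // -?expr2 ?sqr_ge0 // sqrf_eq0 => /andP[/eqP -> /eqP].
by move/IH ->.
Qed.

Lemma measurable_dot n (f g : euclid n -> euclid n) :
  measurable_fun setT f -> measurable_fun setT g ->
  measurable_fun setT (fun x => dot (f x) (g x)).
Proof.
suff H m d (T : measurableType d) (h k : T -> euclid m) :
    measurable_fun setT h -> measurable_fun setT k ->
    measurable_fun setT (fun x => dot (h x) (k x)) by exact: H.
elim: m h k => [|m IH] h k mh mk /=; first exact: measurable_cst.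
apply: measurable_funD.
  apply: measurable_funM.
    exact: (measurableT_comp measurable_fst mh).
  exact: (measurableT_comp measurable_fst mk).
by apply: IH; [exact: (measurableT_comp measurable_snd mh)
              |exact: (measurableT_comp measurable_snd mk)].
Qed.

Definition vol_isometry n (f : euclid n -> euclid n) : Prop :=
  preserving (vol n) f /\ forall x y, dot (f x) (f y) = dot x y.

Lemma vol_isometry_id n : @vol_isometry n id.
Proof. by split=> //; exact: preserving_id. Qed.

Lemma vol_isometry_comp n (f g : euclid n -> euclid n) :
  vol_isometry f -> vol_isometry g -> vol_isometry (f \o g).
Proof.
move=> [pf df] [pg dg]; split; first exact: preserving_comp.
by move=> x y; rewrite /= df dg.
Qed.

Lemma vol_isometry_tail n (f : euclid n -> euclid n) :
  vol_isometry f ->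
  @vol_isometry n.+1 (fun x => (x.1, f x.2)).
Proof.
move=> [pf df]; split; last by move=> x y /=; rewrite df.
apply: (@preserving_fiberwise _ _ _ _ _ _ (vol n) (fun=> f)) => //.
apply: measurable_fun_pair => //; exact: (measurableT_comp pf.1).
Qed.

Definition rot2 n (c s : R) : euclid n.+2 -> euclid n.+2 :=
  fun x => (c * x.1 - s * x.2.1, (s * x.1 + c * x.2.1, x.2.2)).

Lemma preserving_shear1 n (a : R) :
  preserving (vol n.+2) (fun x => ((x.1 : R) + a * x.2.1, x.2)).
Proof.
apply: (@preserving_shear _ _ _ (vol n.+1) (fun y => a * y.1)).
by apply: measurable_funM.
Qed.

Lemma preserving_shear2 n (a : R) :
  preserving (vol n.+2) (fun x => (x.1, ((x.2.1 : R) + a * x.1, x.2.2))).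
Proof.
apply: (@preserving_fiberwise _ _ _ _ _ (@lebesgue_measure R) (vol n.+1)
  (fun x y => ((y.1 : R) + a * x, y.2))) => [|x].
  apply: measurable_fun_pair => //.
  apply: measurable_fun_pair; last exact: (measurableT_comp measurable_snd).
  apply: measurable_funD; first exact: (measurableT_comp measurable_fst).
  by apply: measurable_funM.
exact: (@preserving_shear _ _ _ (vol n) (fun=> a * x)).
Qed.

(* A rotation is a product of three shears, except the half turn [c = -1],
   which is the square of a quarter turn. *)
Lemma vol_isometry_rot2 n (c s : R) :
  c ^+ 2 + s ^+ 2 = 1 -> vol_isometry (@rot2 n c s).
Proof.
have main c' s' : c' ^+ 2 + s' ^+ 2 = 1 -> c' != -1 -> vol_isometry (@rot2 n c' s').
  move=> cs1 cN1; split; last first.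
    move=> [x1 [x2 x]] [y1 [y2 y]] /=.
    rewrite !addrA; congr (_ + _).
    by rewrite -[RHS]mul1r -cs1; ring.
  have c1 : 1 + c' != 0 by rewrite addrC -subr_eq0 opprK in cN1 *.
  (* For [c'] and [s'] the cosine and sine of an angle, the outer coefficient is minus the tangent
     of the half angle. *)
  have := preserving_comp (preserving_shear1 n (- s' / (1 + c')))
    (preserving_comp (preserving_shear2 n s') (preserving_shear1 n (- s' / (1 + c')))).
  rewrite (_ : _ \o _ = @rot2 n c' s') //.
  apply/funext => -[x1 [x2 x]]; rewrite /rot2 /=.
  have s2 : s' ^+ 2 = (1 - c') * (1 + c') by rewrite -(addKr (c' ^+ 2) (s' ^+ 2)) cs1; ring.
  rewrite !mulNr; set t := s' / (1 + c').
  have E1 : s' * t - (1 - c') = 0 by rewrite mulrA -expr2 s2 mulfK // subrr.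
  have E2 : s' - t * (1 + c') = 0 by rewrite divfK // subrr.
  congr (_, (_, _)); apply/subr0_eq.
    transitivity ((s' * t - (1 - c')) * (t * x2 - x1) + x2 * (s' - t * (1 + c'))).
      by ring.
    by rewrite E1 E2 mul0r mulr0 addr0.
  transitivity (- x2 * (s' * t - (1 - c'))); first by ring.
  by rewrite E1 mulr0.
move=> cs1; have [cN1|] := eqVneq c (-1); last exact: main.
have -> : @rot2 n c s = @rot2 n 0 1 \o @rot2 n 0 1.
  have s0 : s = 0.
    by apply/eqP; rewrite -sqrf_eq0 -(addKr (c ^+ 2) (s ^+ 2)) cs1 cN1; apply/eqP; ring.
  by apply/funext => -[x1 [x2 x]]; rewrite /rot2 /= cN1 s0; congr (_, (_, _)); ring.
have q : vol_isometry (@rot2 n 0 1).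
  by apply: main; [ring|rewrite eq_sym oppr_eq0 oner_eq0].
exact: vol_isometry_comp.
Qed.

(* [f] is a product of rotations, so the sign of [a] cannot be chosen in
   dimension 1. *)
Lemma exists_isometry_axis n (u : euclid n.+1) :
  exists2 f, vol_isometry f & exists a : R, f u = (a, vec0 n) /\ ((0 < n)%N -> 0 <= a).
Proof.
elim: n u => [|n IH] [a u].
  by exists id; [exact: vol_isometry_id|exists a; split => //; case: u].
have [f fiso [b [fu _]]] := IH u.
pose r := Num.sqrt (a ^+ 2 + b ^+ 2).
have r2 : r ^+ 2 = a ^+ 2 + b ^+ 2 by rewrite sqr_sqrtr // addr_ge0 // sqr_ge0.
have [r0|r0] := eqVneq r 0.
  move: r2; rewrite r0 expr0n /= => /esym/eqP.
  rewrite paddr_eq0 ?sqr_ge0 // !sqrf_eq0 => /andP[/eqP a0 /eqP b0].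
  exists (fun x => (x.1, f x.2)); first exact: vol_isometry_tail.
  by exists 0; split => //=; rewrite fu a0 b0.
exists (@rot2 n (a / r) (- b / r) \o (fun x => (x.1, f x.2))).
  apply: vol_isometry_comp (vol_isometry_tail fiso).
  apply: vol_isometry_rot2; rewrite !expr_div_n sqrrN -mulrDl -r2 divff //.
  by rewrite expf_neq0.
exists r; split; last by rewrite sqrtr_ge0.
rewrite /rot2 /= fu /=; congr (_, (_, _)); last by field.
by apply: (mulIf r0); rewrite -expr2 r2; field.
Qed.

Arguments dot : simpl never.
Arguments vec : simpl never.

Lemma dotS n (a b : R) (x y : euclid n) :
  @dot n.+1 (a, x) (b, y) = a * b + dot x y.
Proof. by []. Qed.

Definition circ n (t : R) : euclid n.+2 := (cos t, (sin t, vec0 n)).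

(** First [u] is rotated onto the first axis, then the tail of the image of [v] onto the second. In
    dimension at least 3 this tail has dimension at least 2, so its coordinate can be made
    nonnegative, as [sin (acos _)] is. *)
Lemma exists_isometry_circ n (u v : euclid n.+3) :
  dot u u = 1 -> dot v v = 1 ->
  exists2 f, vol_isometry f &
    f u = circ n.+1 0 /\ f v = circ n.+1 (acos (dot u v)).
Proof.
move=> u1 v1; have [f fiso [a [fu a0]]] := exists_isometry_axis u.
have [b [w Efv]] : exists (b : R) (w : euclid n.+2), f v = (b, w).
  by exists (f v).1, (f v).2; case: (f v).
have [g giso [s [gw s0]]] := exists_isometry_axis w.
have a1 : a = 1.
  have := fiso.2 u u; rewrite fu u1 dotS dot0v addr0 -expr2 => /eqP.
  by rewrite sqrp_eq1 ?a0 // => /eqP.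
have bE : dot u v = b by rewrite -fiso.2 fu Efv dotS dot0v addr0 a1 mul1r.
have bs : b ^+ 2 + s ^+ 2 = 1.
  by rewrite -v1 -fiso.2 Efv dotS -giso.2 gw dotS dot0v addr0 !expr2.
have b1 : -1 <= b <= 1.
  by have := sqr_ge0 s; move=> s2; apply/andP; split; nra.
exists ((fun x => (x.1, g x.2)) \o f).
  exact: vol_isometry_comp (vol_isometry_tail giso) fiso.
rewrite /= fu Efv /circ cos0 sin0 a1 /= gw; split.
  (* Since [g] preserves [dot], it fixes the origin. *)
  congr (_, _); apply/(@dot_eq0 n.+2).
  by rewrite giso.2 dot0v.
rewrite bE acosK ?in_itv // sin_acos //; congr (_, (_, _)).
by rewrite -bs addrAC subrr add0r sqrtr_sqr ger0_norm // s0.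
Qed.

End euclid.

Local Notation euclid R n := (projT2 (euclid_space R n)).

(** * Hyperplane rounding *)

Section lune.
Variable R : realType.
Local Open Scope classical_set_scope.

Definition halfspace n (u : euclid R n) := [set x | 0 <= dot u x].

(** Here [r] bounds the squared norm, which keeps square roots out of the inductions on the
    dimension. *)
Definition sqball n (r : R) := [set x : euclid R n | dot x x <= r].

(** The points are normals of hyperplanes through the origin that separate [u] from [v]; a vector on
    the hyperplane counts as on the nonnegative side. *)
Definition lune n (u v : euclid R n) :=
  [set x | dot x x <= 1 /\ (0 <= dot u x) != (0 <= dot v x)].

Lemma measurable_halfspace n (u : euclid R n) : measurable (halfspace u).
Proof.
rewrite -[X in measurable X]setTI.
have /(_ measurableT [set true]) := @measurable_fun_ler _ _ R setT (cst 0) (dot u)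
  (measurable_cst _) (measurable_dot (measurable_cst u) (@measurable_id _ _ _)).
exact.
Qed.

Lemma measurable_sqball n r : measurable (@sqball n r).
Proof.
rewrite -[X in measurable X]setTI.
have /(_ measurableT [set true]) := @measurable_fun_ler _ _ R setT (fun x => dot x x) (cst r)
  (@measurable_dot _ n _ _ (@measurable_id _ _ _) (@measurable_id _ _ _)) (measurable_cst _).
exact.
Qed.

Lemma measurable_lune n (u v : euclid R n) : measurable (lune u v).
Proof.
rewrite (_ : lune u v = @sqball n 1 `&`
   ((halfspace u `\` halfspace v) `|` (halfspace v `\` halfspace u))).
  apply: measurableI; first exact: measurable_sqball.
  by apply: measurableU; apply: measurableD; exact: measurable_halfspace.
apply/seteqP; rewrite /lune /halfspace; split=> x /= [x1].
  by case: (0 <= dot u x); case: (0 <= dot v x) => // _; split=> //; [left|right].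
by case=> -[-> /negP/negPf ->].
Qed.

Lemma vol_sqball_fin n r : (vol R n (@sqball n r) < +oo)%E.
Proof.
elim: n => [|n IH] in r *.
  apply: le_lt_trans (_ : vol R 0 setT < _)%E.
    by apply: le_measure; rewrite ?inE //; exact: measurable_sqball.
  by rewrite /= diracT ltry.
(* From [b * b <= r] follows [2 * |b| <= r + 1], a bound without square roots. *)
pose S : set (euclid R n.+1) :=
  (`[- (r + 1), r + 1]%classic : set (measurableTypeR R)) `*` @sqball n r.
have B : @sqball n.+1 r `<=` S.
  move=> [a x] ar; have {}ar : (a : R) * a + dot x x <= r := ar.
  have sub (b y : R) : b * b + y <= r -> 0 <= y -> - (r + 1) <= b <= r + 1 /\ y <= r.
    move=> byr y0; have b0 := sqr_ge0 b; have b1 := sqr_ge0 (b - 1).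
    by have b2 := sqr_ge0 (b + 1); split; [apply/andP; split|]; nra.
  by have [] := sub _ _ ar (dot_ge0 x); split; rewrite //= in_itv.
apply: (@le_lt_trans _ _ (vol R n.+1 S)).
  apply: le_measure B; rewrite ?inE; first exact: measurable_sqball.
  by apply: measurableX => //; exact: measurable_sqball.
rewrite /= /sfprod product_measure1E //; last exact: measurable_sqball.
rewrite lte_mul_pinfty // ge0_fin_numE //.
rewrite [X in (X < _)%E](@lebesgue_measure_itv R `[- (r + 1), r + 1]%R); case: ifP => // _.
by rewrite -EFinB ltry.
Qed.

Lemma vol_sqball_gt0 n r : 0 < r -> (0 < vol R n (@sqball n r))%E.
Proof.
elim: n => [|n IH] in r * => r0.
  by rewrite /= diracE mem_set //= /sqball /= ltW.
(* On [[0, s]] the two bounds on [s] give [a * a <= s <= r / 2]. *)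
pose s := Num.min 1 (r / 2); have s0 : 0 < s by rewrite lt_min ltr01 divr_gt0.
have s1 : s <= 1 by rewrite ge_min lexx.
have sr : s <= r / 2 by rewrite ge_min lexx orbT.
pose S : set (euclid R n.+1) :=
  (`[0, s]%classic : set (measurableTypeR R)) `*` @sqball n (r / 2).
apply: (@lt_le_trans _ _ (vol R n.+1 S)).
  rewrite /= /sfprod product_measure1E //; last exact: measurable_sqball.
  rewrite mule_gt0 ?IH ?divr_gt0 //.
  rewrite [X in (_ < X)%E](@lebesgue_measure_itv R `[0, s]%R) /= lte_fin s0.
  by rewrite sube0 lte_fin.
apply: le_measure; rewrite ?inE; last 1 first.
- move=> [a x] [] /=; rewrite in_itv /= => /andP[a0 a1].
  rewrite /sqball /= => xr; change ((a : R) * a + dot x x <= r).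
  have : a * a <= s * 1 by apply: ler_pM => //; exact: le_trans a1 s1.
  lra.
- by apply: measurableX => //; exact: measurable_sqball.
- exact: measurable_sqball.
Qed.

Lemma vol_lune_fin n (u v : euclid R n) : vol R n (lune u v) \is a fin_num.
Proof.
rewrite ge0_fin_numE //; apply: le_lt_trans (vol_sqball_fin n 1).
apply: le_measure; rewrite ?inE; [exact: measurable_lune|exact: measurable_sqball|].
by move=> x [].
Qed.

Definition lune_vol n (u v : euclid R n) : R := fine (vol R n (lune u v)).
Definition ball_vol n : R := fine (vol R n (@sqball n 1)).

Lemma lune_vol_ge0 n (u v : euclid R n) : 0 <= lune_vol u v.
Proof. exact: fine_ge0. Qed.

Lemma ball_vol_gt0 n : 0 < ball_vol n.
Proof. by rewrite fine_gt0 // vol_sqball_gt0 //= vol_sqball_fin. Qed.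

(** By invariance of [dot], the preimage under [f] of the lune of [f u] and [f v] is the lune of [u]
    and [v]. *)
Lemma lune_vol_isometry n f (u v : euclid R n) :
  vol_isometry f -> lune_vol (f u) (f v) = lune_vol u v.
Proof.
move=> [[mf pf] df]; rewrite /lune_vol -[in LHS]pf; last exact: measurable_lune.
by congr (fine (vol R n _)); apply/seteqP; split=> x; rewrite /lune /= !df.
Qed.

(** A hyperplane separating [u] from [w] separates [v] from one of them. *)
Lemma lune_volD n (u v w : euclid R n) :
  lune_vol u w <= lune_vol u v + lune_vol v w.
Proof.
rewrite -fineD ?vol_lune_fin // fine_le ?fin_numD ?vol_lune_fin //.
apply: le_trans (measureU2 (vol R n) (measurable_lune u v) (measurable_lune v w)).
apply: le_measure; rewrite ?inE; first exact: measurable_lune.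
  by apply: measurableU; exact: measurable_lune.
move=> x [x1 /= uw].
have [uv|uv] := eqVneq (0 <= dot u x) (0 <= dot v x); last by left.
by right; split => //; rewrite -uv.
Qed.

(** As a nonnegative combination, [v] lies on the common side whenever [u] and [w] share one;
    [0 < a + b] keeps it strictly negative when both are. So no hyperplane separates [v] from both,
    and the two lunes partition the large one. *)
Lemma lune_vol_add n (u v w : euclid R n) (a b : R) :
  0 <= a -> 0 <= b -> 0 < a + b ->
  (forall x, dot v x = a * dot u x + b * dot w x) ->
  lune_vol u w = lune_vol u v + lune_vol v w.
Proof.
move=> a0 b0 ab vE.
have btw x : (0 <= dot u x) = (0 <= dot w x) -> (0 <= dot v x) = (0 <= dot u x).
  rewrite vE; case: (lerP 0 (dot u x)) => ux; case: (lerP 0 (dot w x)) => wx // _.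
    by rewrite addr_ge0 // mulr_ge0.
  apply/negbTE; rewrite -ltNge.
  have := ler_wpM2l a0 (ltW ux); have := ler_wpM2l b0 (ltW wx); rewrite !mulr0.
  move=> bw au; rewrite lt_neqAle -[X in _ <= X](addr0 0) lerD // andbT.
  apply/eqP => e0; have {bw au} [bw au] : b * dot w x = 0 /\ a * dot u x = 0 by lra.
  move: ab; move/eqP: bw; move/eqP: au.
  by rewrite !mulf_eq0 !(lt_eqF ux, lt_eqF wx) !orbF => /eqP -> /eqP ->; rewrite addr0 ltxx.
rewrite -fineD ?vol_lune_fin // /lune_vol -measureU //; try exact: measurable_lune.
  congr (fine (vol R n _)); apply/seteqP; split=> x.
    case=> x1 uw.
    have [uv|uv] := eqVneq (0 <= dot u x) (0 <= dot v x); last by left.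
    by right; split => //; rewrite -uv.
  case=> -[x1 h]; split => //; apply: contra h => /eqP uw.
    by rewrite (btw x uw).
  by rewrite (btw x uw) uw.
apply/seteqP; split=> x //= [[x1 uv] [_ vw]].
move: (btw x) uv vw.
by case: (0 <= dot u x); case: (0 <= dot v x); case: (0 <= dot w x) => // /(_ erefl).
Qed.

End lune.

(** * The volume of a lune as a function of the angle *)

Section angle.
Variable R : realType.
Local Open Scope classical_set_scope.

Lemma dot_circ n t (x : euclid R n.+2) :
  dot (circ n t) x = cos t * x.1 + sin t * x.2.1.
Proof.
case: x => a [b x] /=; rewrite -[LHS]/(cos t * a + (sin t * b + dot (vec n (fun=> 0 : R)) x)).
by rewrite dot0v addr0.
Qed.

Definition circ_lune n (t : R) : R := lune_vol (circ n 0) (circ n t).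

(** Rotation by [a] carries the points at angles [0] and [b - a] to those at [a] and [b]. *)
Lemma lune_vol_circ n (a b : R) :
  lune_vol (circ n a) (circ n b) = circ_lune n (b - a).
Proof.
have rotE t : rot2 (cos a) (sin a) (circ n t) = circ n (a + t).
  by rewrite /rot2 /circ /= cosD sinD.
rewrite /circ_lune.
rewrite -(lune_vol_isometry (circ n 0) (circ n (b - a)) (vol_isometry_rot2 n (cos2Dsin2 a))).
by rewrite !rotE addr0 addrC subrK.
Qed.

Lemma circ_luneD n (s t : R) :
  circ_lune n (s + t) <= circ_lune n s + circ_lune n t.
Proof.
apply: le_trans (lune_volD _ (circ n s) _) _.
by rewrite !lune_vol_circ subr0 (addrC s) addrK.
Qed.

Lemma circ_lune0 n : circ_lune n 0 = 0.
Proof.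
rewrite /circ_lune /lune_vol (_ : lune _ _ = set0) ?measure0 //.
by apply/seteqP; split=> x // [_]; rewrite eqxx.
Qed.

(** By the sine rule, [circ n s] combines [circ n 0] and [circ n (s + t)] with the weights
    [sin t / sin (s + t)] and [sin s / sin (s + t)], nonnegative as long as [0 < s + t < pi]. *)
Lemma circ_lune_add n (s t : R) : 0 <= s -> 0 <= t -> s + t < pi ->
  circ_lune n (s + t) = circ_lune n s + circ_lune n t.
Proof.
move=> s0 t0 stpi.
have [st0|st0] := eqVneq (s + t) 0.
  have [-> ->] : s = 0 /\ t = 0 by lra.
  by rewrite addr0 circ_lune0 addr0.
have stgt0 : 0 < s + t by rewrite lt_neqAle eq_sym st0 addr_ge0.
have sinst : 0 < sin (s + t) by apply: sin_gt0_pi; rewrite stgt0.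
have ss : 0 <= sin s by apply: sin_ge0_pi; lra.
have st : 0 <= sin t by apply: sin_ge0_pi; lra.
have E : circ_lune n t = lune_vol (circ n s) (circ n (s + t)).
  by rewrite lune_vol_circ (addrC s) addrK.
rewrite E; apply: (@lune_vol_add _ _ _ _ _ (sin t / sin (s + t)) (sin s / sin (s + t))).
- exact: divr_ge0 st (ltW sinst).
- exact: divr_ge0 ss (ltW sinst).
- rewrite -mulrDl; apply: (divr_gt0 _ sinst); rewrite lt_neqAle (addr_ge0 st ss) andbT.
  rewrite eq_sym (paddr_eq0 st ss); apply/negP => /andP[/eqP t1 /eqP s1].
  by move: sinst; rewrite sinD t1 s1 mul0r mulr0 addr0 ltxx.
have sn0 : sin (s + t) != 0 by rewrite gt_eqF.
have c1 : cos s = sin t / sin (s + t) + sin s / sin (s + t) * cos (s + t).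
  have -> : sin t = sin (s + t) * cos s - cos (s + t) * sin s.
    by rewrite -sinB (addrC s) addrK.
  by move: sn0; move: (sin (s + t)) (cos (s + t)) => y z yn0; field.
have c2 : sin s = sin s / sin (s + t) * sin (s + t) by rewrite divfK.
move=> x; rewrite !dot_circ sin0 cos0; move: c1 c2; set al := sin t / _; set be := sin s / _.
by move=> -> ->; ring.
Qed.

(** Antipodal points are separated by every hyperplane whose normal has a nonzero first coordinate,
    and the remaining normals lie in the null set [Z]. *)
Lemma circ_lune_pi n : ball_vol R n.+2 <= circ_lune n pi.
Proof.
pose Z : set (euclid R n.+2) := ([set 0] : set (measurableTypeR R)) `*` setT.
have mZ : measurable Z by apply: measurableX.
have Z0 : vol R n.+2 Z = 0%E.
  by rewrite /= /sfprod product_measure1E // [X in (X * _)%E](@lebesgue_measure_set1 R 0) mul0e.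
apply: fine_le; [|exact: vol_lune_fin|].
  by rewrite ge0_fin_numE ?measure_ge0 ?vol_sqball_fin.
set L := lune _ _; have mL : measurable L by exact: measurable_lune.
have : (vol R n.+2 (L `|` Z) <= vol R n.+2 L + vol R n.+2 Z)%E by exact: measureU2.
rewrite Z0 adde0; apply: le_trans.
apply: le_measure; rewrite ?inE; first exact: measurable_sqball.
  by apply: measurableU => //; exact: measurable_lune.
move=> x x1; have [x0|x0] := eqVneq (x.1 : R) 0; first by right; case: x x1 x0.
left; split => //; rewrite !dot_circ cos0 sin0 cospi sinpi !mul0r !addr0 mul1r mulN1r.
by rewrite oppr_ge0 eq_sym; case: ltgtP x0.
Qed.

(* Subadditivity up to [p] bounds [G (p / N)] below; additivity short of [p]
   propagates the bound to the multiples of [p / N]. *)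
Lemma le_additive_linear (G : R -> R) (M p : R) :
  0 < M -> 0 < p -> G 0 = 0 -> (forall t, 0 <= G t) ->
  (forall s t, G (s + t) <= G s + G t) ->
  (forall s t, 0 <= s -> 0 <= t -> s + t < p -> G (s + t) = G s + G t) ->
  M <= G p -> forall t, 0 <= t <= p -> t / p * M <= G t.
Proof.
move=> M0 p0 G0 Gge GD Gadd GM t /andP[t0]; have pn0 : p != 0 by rewrite gt_eqF.
rewrite le_eqVlt => /predU1P[->|tp]; first by rewrite divff ?mul1r.
have Gmul k s : G (s *+ k) <= G s *+ k.
  elim: k => [|k IH]; first by rewrite !mulr0n G0.
  by rewrite !mulrS (le_trans (GD _ _)) // lerD2l.
have Gmul_eq k s : 0 <= s -> s *+ k < p -> G (s *+ k) = G s *+ k.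
  move=> s0; elim: k => [|k IH] ks; first by rewrite !mulr0n G0.
  move: ks; rewrite !mulrS => ks; rewrite Gadd ?mulrn_wge0 // IH //.
  by apply: le_lt_trans ks; rewrite lerDr.
rewrite leNgt; apply/negP => h.
have d0 : 0 < t / p * M - G t by rewrite subr_gt0.
(* With this [N], the error [M / N] made by rounding [t] down to a multiple of [p / N] is below the
   assumed gap. *)
have [N NM] : exists N : nat, M / (t / p * M - G t) < N%:R.
  by exists (Num.truncn (M / (t / p * M - G t))).+1; rewrite truncnS_gt.
have N0 : 0 < N%:R :> R by apply: le_lt_trans NM; rewrite ltW // divr_gt0.
have Nn0 : N%:R != 0 :> R by rewrite gt_eqF.
have [u uE] : exists u : R, u = p / N%:R by exists (p / N%:R).
have u0 : 0 < u by rewrite uE divr_gt0.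
have uN : u *+ N = p by rewrite -[LHS]mulr_natr uE divfK.
have [k k1 k2] : exists2 k : nat, k%:R <= t / u & t / u < k.+1%:R.
  have tu0 : 0 <= t / u by rewrite divr_ge0 // ltW.
  by exists (Num.truncn (t / u)); have /andP[] := truncn_itv tu0.
have kut : u *+ k <= t by rewrite -mulr_natl -ler_pdivlMr.
have uk0 : 0 <= u *+ k by exact: mulrn_wge0 (ltW u0).
have Gu : M / N%:R <= G u.
  by rewrite ler_pdivrMr // mulr_natr -uN in GM *; exact: le_trans GM (Gmul _ _).
have Gt : G u *+ k <= G t.
  rewrite -(Gmul_eq k u (ltW u0) (le_lt_trans kut tp)).
  have tE : u *+ k + (t - u *+ k) = t by rewrite addrC subrK.
  have := Gadd (u *+ k) (t - u *+ k); rewrite tE subr_ge0 => ->//.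
  by rewrite lerDl.
have Gt2 : (t / u - 1) * (M / N%:R) <= G t.
  apply: le_trans Gt; rewrite -[leRHS]mulr_natl.
  apply: (@le_trans _ _ (k%:R * (M / N%:R))); last by rewrite ler_wpM2l.
  by rewrite ler_wpM2r ?(divr_ge0 (ltW M0) (ltW N0)) // lerBlDr natr1 ltW.
have E : (t / u - 1) * (M / N%:R) = t / p * M - M / N%:R.
  by rewrite uE; field; rewrite pn0 Nn0.
have : M / N%:R < t / p * M - G t by rewrite ltr_pdivrMr // mulrC -ltr_pdivrMr.
by rewrite E in Gt2; lra.
Qed.

Lemma circ_lune_ge n (t : R) : 0 <= t <= pi ->
  t / pi * ball_vol R n.+2 <= circ_lune n t.
Proof.
apply: le_additive_linear => [|||s|s u|s u|].
- exact: ball_vol_gt0.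
- exact: pi_gt0.
- exact: circ_lune0.
- exact: lune_vol_ge0.
- exact: circ_luneD.
- exact: circ_lune_add.
- exact: circ_lune_pi.
Qed.

Lemma lune_vol_ge n (u v : euclid R n.+3) : dot u u = 1 -> dot v v = 1 ->
  -1 <= dot u v <= 1 ->
  acos (dot u v) / pi * ball_vol R n.+3 <= lune_vol u v.
Proof.
move=> u1 v1 uv; have [f fiso [fu fv]] := exists_isometry_circ u1 v1.
rewrite -(lune_vol_isometry u v fiso) fu fv circ_lune_ge //.
by rewrite acos_ge0 ?acos_lepi.
Qed.

End angle.

(** * From random hyperplanes to a distribution on cuts *)

Section rounding.
Variable R : realType.
Local Open Scope classical_set_scope.

Lemma fine_measure_fibers d (T : measurableType d) (mu : {measure set T -> \bar R})
    (I : finType) (f : T -> I) (B : set T) (P : pred I) :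
  (mu B < +oo)%E -> measurable B ->
  (forall i, measurable [set x | B x /\ f x = i]) ->
  fine (mu [set x | B x /\ P (f x)]) =
    \sum_(i | P i) fine (mu [set x | B x /\ f x = i]).
Proof.
move=> Boo mB mf; pose r := [seq i <- index_enum I | P i].
have cellE i : mu [set x | B x /\ f x = i] = (fine (mu [set x | B x /\ f x = i]))%:E.
  rewrite fineK // ge0_fin_numE //; apply: le_lt_trans Boo.
  by apply: le_measure; rewrite ?inE // => x [].
have -> : [set x | B x /\ P (f x)] = \bigcup_(i in [set` r]) [set x | B x /\ f x = i].
  apply/seteqP; split=> x /= => [[Bx Px]|[i /=]].
    by exists (f x) => //=; rewrite mem_filter Px mem_index_enum.
  by rewrite mem_filter => /andP[Pi _] [Bx ->].
rewrite measure_fin_bigcup //.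
- rewrite -fsbig_seq ?filter_uniq ?index_enum_uniq // big_filter.
  by rewrite (eq_bigr _ (fun i _ => cellE i)) sumEFin.
- by move=> i j _ _ [x [[_ <-] [_ <-]]].
Qed.

(** The weight [p S] is the proportion of normals in the unit ball that have exactly the vectors of
    [S] on their nonnegative side. The probability of separating [i] from [j] is then the relative
    volume of a lune. *)
Lemma hyperplane_rounding (V : finType) n (u : V -> nat -> R) :
  (forall i, \sum_(l < n.+3) u i l * u i l = 1) ->
  exists p : {set V} -> R, [/\ forall S, 0 <= p S, \sum_S p S = 1 &
    forall i j, -1 <= \sum_(l < n.+3) u i l * u j l <= 1 /\
      acos (\sum_(l < n.+3) u i l * u j l) / pi <=
      \sum_S p S * cut_ind R S i j].
Proof.
move=> u1; pose w i := vec n.+3 (u i).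
have dotw i j : dot (w i) (w j) = \sum_(l < n.+3) u i l * u j l by exact: dot_vec.
have dot1 i : dot (w i) (w i) = 1 by rewrite dotw.
(* Cauchy-Schwarz for unit vectors, from the squared norms of their sum and difference. *)
have dotN1 i j : -1 <= dot (w i) (w j) <= 1.
  have sq (a b : R) : 0 <= \sum_(l < n.+3) (a * u i l + b * u j l) ^+ 2.
    by apply: sumr_ge0 => l _; exact: sqr_ge0.
  have {}sq (a b : R) : 0 <= a ^+ 2 + b ^+ 2 + a * b * dot (w i) (w j) *+ 2.
    apply: le_trans (sq a b) _; rewrite le_eqVlt; apply/orP; left; apply/eqP.
    rewrite -[a ^+ 2]mulr1 -[b ^+ 2]mulr1 -{1}(u1 i) -(u1 j) dotw.
    rewrite !mulr_sumr -sumrMnl -!big_split /=; apply: eq_bigr => l _; ring.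
  have := sq 1 1; have := sq 1 (-1); set x := dot _ _ => h1 h2.
  by apply/andP; split; lra.
pose B := @sqball R n.+3 1; pose f x := [set i | 0 <= dot (w i) x]%SET.
have mB : measurable B by exact: measurable_sqball.
have Boo : (vol R n.+3 B < +oo)%E by exact: vol_sqball_fin.
have mf S : measurable [set x | B x /\ f x = S].
  rewrite (_ : [set x | _] = B `&` \bigcap_(i in [set: V])
      (if i \in S then halfspace (w i) else ~` halfspace (w i))).
    apply: measurableI => //; apply: fin_bigcap_measurable => // i _.
    by case: ifP => _; [|apply: measurableC]; exact: measurable_halfspace.
  apply/seteqP; split=> x /= [Bx] => [<-|H]; split=> //.
    move=> i _; rewrite inE; case: ifPn => //; exact/negP.
  apply/setP => i; rewrite inE; have := H i I.
  by case: ifPn => // _; rewrite /halfspace /= => /negP/negbTE.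
have M0 := ball_vol_gt0 R n.+3.
pose p S := fine (vol R n.+3 [set x | B x /\ f x = S]) / ball_vol R n.+3.
exists p; split=> [S||i j].
- exact: divr_ge0 (fine_ge0 (measure_ge0 _ _)) (ltW M0).
- rewrite -mulr_suml -(@fine_measure_fibers _ _ _ _ _ _ predT Boo mB mf).
  rewrite (_ : [set x | _] = B); last by apply/seteqP; split=> x //= [].
  exact: divff (lt0r_neq0 M0).
rewrite -dotw; split; first exact: dotN1.
have -> : \sum_S p S * cut_ind R S i j = lune_vol (w i) (w j) / ball_vol R n.+3.
  rewrite (eq_bigr (fun S : {set V} => if (i \in S) != (j \in S) then p S else 0)); last first.
    by move=> S _; rewrite /cut_ind; case: (_ != _); rewrite ?mulr1 ?mulr0.
  rewrite -big_mkcond -mulr_suml.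
  rewrite -(@fine_measure_fibers _ _ _ _ _ _
    (fun S : {set V} => (i \in S) != (j \in S)) Boo mB mf).
  rewrite (_ : [set x | _] = lune (w i) (w j)); first exact: erefl.
  by apply/seteqP; split=> x /= [Bx]; rewrite !inE.
have := lune_vol_ge (dot1 i) (dot1 j) (dotN1 i j).
move: M0; move: (ball_vol _ _) (lune_vol _ _) (acos _ / pi) => M L a M0.
by rewrite -ler_pdivlMr.
Qed.

End rounding.

(** * The Goemans-Williamson constant *)

Section alphaGW.
Variable R : realType.
Local Open Scope classical_set_scope.

Lemma sin_le_id (x : R) : 0 <= x -> sin x <= x.
Proof.
rewrite le_eqVlt => /predU1P[<-|x0]; first by rewrite sin0.
have [|c _] := @MVT R sin cos 0 x x0 (fun y _ => is_derive_sin y).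
  by apply: continuous_subspaceT; exact: continuous_sin.
rewrite sin0 !subr0 => ->.
by rewrite ler_piMl ?cos_le1 // ltW.
Qed.

Lemma one_sub_cos_le (x : R) : 0 <= x -> 1 - cos x <= x ^+ 2.
Proof.
rewrite le_eqVlt => /predU1P[<-|x0]; first by rewrite cos0 subrr expr0n.
have [|c c0x] := @MVT R cos (fun z => - sin z) 0 x x0 (fun y _ => is_derive_cos y).
  by apply: continuous_subspaceT; exact: continuous_cos.
rewrite cos0 subr0 => /(congr1 -%R); rewrite opprB mulNr opprK => ->.
move: c0x; rewrite in_itv /= => /andP[c0 cx].
by rewrite expr2 ler_wpM2r ?(ltW x0) // (le_trans (sin_le_id (ltW c0))) // ltW.
Qed.

Lemma cos_lt1 (x : R) : 0 < x <= pi -> cos x < 1.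
Proof.
move=> /andP[x0 xpi]; rewrite -(@cos0 R) ltr_cos // in_itv /= ?lexx ?pi_ge0 //.
by rewrite ltW.
Qed.

(** The quotient attains a minimum on the compact interval [[2 / pi, pi]] by continuity, and to the
    left of it the quotient is at least its value at [pi]. *)
Lemma alphaGW_is_min :
  is_min [set 2 / pi * (t / (1 - cos t)) | t in [set t : R | 0 < t <= pi]]
    (alphaGW R).
Proof.
pose h (t : R) := t / (1 - cos t).
have p0 := pi_gt0 R; have p2 := pi_ge2 R.
have pos (t : R) : 0 < t <= pi -> 0 < 1 - cos t by move=> /cos_lt1; rewrite subr_gt0.
(* [t / (1 - cos t) >= 1 / t] exceeds its value [pi / 2] at [pi] for [t < 2 / pi]. *)
pose a : R := 2 / pi.
have a0 : 0 < a by rewrite divr_gt0.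
have api : a <= pi by rewrite ler_pdivrMr // -expr2; nra.
have in0 t : t \in `[a, pi]%R -> 0 < t <= pi.
  by rewrite in_itv /= => /andP[at0 ->]; rewrite (lt_le_trans a0).
have [|c /in0 c0 hc] := @EVT_min R h a pi api.
  apply: continuous_in_subspaceT => t; rewrite inE => /in0 /pos t0.
  apply: cvgM; first exact: cvg_id.
  apply: cvgV; first by rewrite gt_eqF.
  by apply: cvgB; [exact: cvg_cst|exact: continuous_cos].
have min t : 0 < t <= pi -> h c <= h t.
  move=> /andP[t0 tpi]; have [tle|tgt] := lerP a t.
    by apply: hc; rewrite in_itv /= tle.
  apply: le_trans (_ : h pi <= _).
    by apply: hc; rewrite in_itv /= api lexx.
  rewrite /h cospi opprK; have t1 : 0 < 1 - cos t by apply: pos; rewrite t0.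
  rewrite ler_pdivlMr // mulrAC ler_pdivrMr //.
  have ct := one_sub_cos_le (ltW t0).
  have tp : t * pi <= 2 by rewrite -ler_pdivlMr // ltW.
  have : pi * (1 - cos t) <= pi * t ^+ 2 by rewrite ler_wpM2l // ltW.
  nra.
have m : is_min [set 2 / pi * (t / (1 - cos t)) | t in [set t : R | 0 < t <= pi]]
    (2 / pi * h c).
  split; first by exists c.
  by move=> _ [t t0 <-]; rewrite ler_wpM2l ?min // ltW.
by rewrite /alphaGW (set_min_eq m).
Qed.

Lemma alphaGW_gt0 : 0 < alphaGW R.
Proof.
have [[t t0 <-] _] := alphaGW_is_min; rewrite mulr_gt0 ?divr_gt0 ?pi_gt0 //.
  by case/andP: t0.
by rewrite subr_gt0 cos_lt1.
Qed.

(** This is the minimality of [alphaGW] at the angle [acos x]; for [x = 1] the angle is outside the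
    range of the minimum, but both sides vanish. *)
Lemma alphaGW_le_acos (x : R) : -1 <= x <= 1 ->
  alphaGW R * ((1 - x) / 2) <= acos x / pi.
Proof.
move=> x1; have [->|xn1] := eqVneq x 1.
  by rewrite subrr mul0r mulr0 acos1 mul0r.
have xlt1 : x < 1 by rewrite lt_neqAle xn1; case/andP: x1.
have t0 : 0 < acos x <= pi.
  by rewrite acos_lepi // acos_gt0 // xlt1; case/andP: x1 => ->.
have /= := alphaGW_is_min.2 _ (ex_intro2 _ _ (acos x) t0 erefl).
rewrite acosK ?in_itv //; have p0 := pi_gt0 R.
have x0 : 0 < 1 - x by rewrite subr_gt0.
have x0' : 1 - x != 0 by rewrite gt_eqF.
have p0' : pi != 0 :> R by rewrite gt_eqF.
move: (alphaGW R) (acos x) pi x0' p0' p0 => al ac p x0' p0' p0 h.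
have := ler_wpM2r (ltW x0) h.
have -> : 2 / p * (ac / (1 - x)) * (1 - x) = 2 * (ac / p) by field; rewrite p0' x0'.
lra.
Qed.

End alphaGW.

(** * Spectral lower bound for traces *)

Section spectral.
Variable R : realType.

Local Notation f := (real_complex R).

Lemma real_complex_real (x : R) : f x \is Num.real.
Proof. by rewrite realE -[0]/(f 0) !lecR -realE num_real. Qed.

(** Splitting [w] into real and imaginary parts, the cross terms cancel by symmetry of [N]. The
    complex form is needed because the spectral theorem yields complex eigenvectors. *)
Lemma psdmx_complex n (N : 'M[R]_n) (w : 'rV[R[i]]_n) : psdmx N ->
  0 <= (w *m map_mx f N *m (map_mx Num.conj w)^T) 0 0.
Proof.
move=> [Nsym Npos].
pose a := map_mx (@complex.Re R) w; pose b := map_mx (@complex.Im R) w.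
have wE : w = map_mx f a + 'i%C *: map_mx f b.
  by apply/matrixP => i j; rewrite !mxE -complexE.
have cE : (map_mx Num.conj w)^T = (map_mx f a)^T - 'i%C *: (map_mx f b)^T.
  apply/matrixP => i j; rewrite !mxE; case: (w _ _) => x y.
  by apply/eqP; rewrite eq_complex /=; apply/andP; split; apply/eqP; ring.
have cross : map_mx f b *m map_mx f N *m (map_mx f a)^T =
    map_mx f a *m map_mx f N *m (map_mx f b)^T.
  have tr11 (X : 'M[R[i]]_1) : X^T = X by apply/matrixP => i j; rewrite mxE !ord1.
  have NfT : (map_mx f N)^T = map_mx f N by rewrite -[in RHS]Nsym map_trmx.
  by rewrite -[LHS]tr11 !trmx_mul trmxK NfT mulmxA.
have -> : w *m map_mx f N *m (map_mx Num.conj w)^T =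
    map_mx f (a *m N *m a^T + b *m N *m b^T).
  rewrite cE {1}wE mulmxDl mulmxDl -!scalemxAl !mulmxBr -!scalemxAr cross.
  rewrite scalerBr scalerA -expr2 sqr_i scaleN1r opprK addrA subrK.
  by rewrite map_mxD !map_mxM !map_trmx.
have Np (c : 'rV[R]_n) : 0 <= (c *m N *m c^T) 0 0 by have := Npos c^T; rewrite trmxK.
by rewrite mxE ler0c mxE addr_ge0.
Qed.

(** In a unitary eigenbasis, [\tr N] is a sum of nonnegative numbers [q i] and [\tr (A *m N)] is the
    same sum weighted by the eigenvalues, each at least the smallest one. *)
Lemma symmetric_min_eigenvalue n (A : 'M[R]_n) : (0 < n)%N -> A^T = A ->
  exists2 l, eigenvalue A l &
    forall N, psdmx N -> l * \tr N <= \tr (A *m N).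
Proof.
move=> n0 Asym; pose C : numClosedFieldType := R[i].
pose Ac : 'M[C]_n := map_mx f A.
have Aherm : Ac \is hermsymmx.
  apply: realsym_hermsym.
    by apply/is_hermitianmxP; rewrite expr0 scale1r map_mx_id // map_trmx Asym.
  by apply/mxOverP => i j; rewrite mxE real_complex_real.
have Anormal := hermitian_normalmx Aherm.
pose P := spectralmx Ac; pose D := spectral_diag Ac.
have Pu : P \is unitarymx by exact: spectral_unitarymx.
have AE : Ac = invmx P *m diag_mx D *m P by exact/orthomx_spectralP.
have Dreal i : f (complex.Re (D 0 i)) = D 0 i.
  by apply: RRe_real; have /mxOverP := hermitian_spectral_diag_real Aherm; exact.
pose d i := complex.Re (D 0 i).
case: n n0 => [//|n] _ in A Asym Ac Aherm Anormal P D Pu AE Dreal d *.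
pose m := [arg min_(i < ord0) d i]%O.
have dm i : d m <= d i by rewrite /m; case: arg_minP => // j _; exact.
exists (d m).
  (* It suffices to exhibit a complex eigenvector, here a row of the unitary [P]. *)
  rewrite -(eigenvalue_map f) -/Ac; apply/eigenvalueP; exists (row m P).
    rewrite -row_mul AE !mulmxA mulmxV ?unitarymx_unit // mul1mx.
    by rewrite mul_diag_mx; apply/rowP => j; rewrite !mxE -Dreal.
  apply/negP => /eqP Pm0; have /row_unitarymxP /(_ m m) := Pu.
  by rewrite Pm0 linear0l eqxx => /eqP; rewrite eq_sym oner_eq0.
move=> N Npsd.
pose q i := (row i P *m map_mx f N *m (map_mx Num.conj (row i P))^T) 0 0.
have q0 i : 0 <= q i by exact: psdmx_complex.
pose Nc : 'M[C]_n.+1 := map_mx f N.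
have qE i : (P *m Nc *m invmx P) i i = q i.
  rewrite /q -!row_mul invmx_unitary // !mxE; apply: eq_bigr => k _.
  by rewrite !mxE.
have trN : f (\tr N) = \sum_i q i.
  rewrite -trace_map_mx -/Nc -(mulKmx (spectral_unit Ac) Nc) mxtrace_mulC.
  exact: eq_bigr.
have trAN : f (\tr (A *m N)) = \sum_i D 0 i * q i.
  rewrite -trace_map_mx map_mxM -/Ac -/Nc AE -!mulmxA mxtrace_mulC -!mulmxA.
  by apply: eq_bigr => i _; rewrite mul_diag_mx mxE !mulmxA qE.
have fM : f (d m * \tr N) = f (d m) * \sum_i q i by rewrite -trN -rmorphM.
suff : f (d m * \tr N) <= f (\tr (A *m N)) by rewrite lecR.
rewrite fM trAN mulr_sumr; apply: ler_sum => i _.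
by rewrite -Dreal; apply: ler_wpM2r; [exact: q0|rewrite lecR; exact: dm].
Qed.
End spectral.

(** * The Bose-Mesner algebra of an association scheme *)

Section bose_mesner.
Variables (R : realType) (d : nat).

Definition bose_mesner n (S : 'I_d.+1 -> 'M[R]_n) (M : 'M[R]_n) : Prop :=
  exists a : 'I_d.+1 -> R, M = \sum_l a l *: S l.

Section scheme.
Variables (n : nat) (S : 'I_d.+1 -> 'M[R]_n).
Hypothesis hS : assoc_scheme S.

Lemma bose_mesner_basis i : bose_mesner S (S i).
Proof.
exists (fun l => (l == i)%:R); rewrite (bigD1 i) //= eqxx scale1r big1 ?addr0 //.
by move=> l /negPf ->; rewrite scale0r.
Qed.

Lemma bose_mesnerD M N :
  bose_mesner S M -> bose_mesner S N -> bose_mesner S (M + N).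
Proof.
move=> [a ->] [b ->]; exists (fun l => a l + b l).
by rewrite -big_split; apply: eq_bigr => l _; rewrite scalerDl.
Qed.

Lemma bose_mesnerZ a M : bose_mesner S M -> bose_mesner S (a *: M).
Proof.
move=> [b ->]; exists (fun l => a * b l).
by rewrite scaler_sumr; apply: eq_bigr => l _; rewrite scalerA.
Qed.

Lemma bose_mesner0 : bose_mesner S 0.
Proof.
by exists (fun=> 0); rewrite big1 // => l _; rewrite scale0r.
Qed.

Lemma bose_mesner_sum (I : finType) (F : I -> 'M[R]_n) :
  (forall i, bose_mesner S (F i)) -> bose_mesner S (\sum_i F i).
Proof.
move=> hF; apply: (big_ind (bose_mesner S)) => //; first exact: bose_mesner0.
exact: bose_mesnerD.
Qed.

Lemma bose_mesnerM M N :
  bose_mesner S M -> bose_mesner S N -> bose_mesner S (M *m N).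
Proof.
case: hS => _ _ _ [p pE] [a ->] [b ->].
rewrite mulmx_suml; apply: bose_mesner_sum => i; rewrite mulmx_sumr.
apply: bose_mesner_sum => j; rewrite -scalemxAl -scalemxAr pE.
by do 2! apply: bose_mesnerZ; exists (fun l => (p i j l)%:R).
Qed.

Lemma bose_mesner_sym M : bose_mesner S M -> M^T = M.
Proof.
case: hS => hS1 _ _ _ [a ->]; rewrite linear_sum; apply: eq_bigr => l _.
by rewrite linearZ /=; case: (hS1 l) => _ ->.
Qed.

(** A member of the scheme either has zero diagonal or is a diagonal matrix; in the second case it
    commutes with the all-ones matrix, which makes its diagonal constant. *)
Lemma bose_mesner_diag M : bose_mesner S M -> forall x y, M x x = M y y.
Proof.
case: (hS) => hS1 hJ hD _ [a ->] x y; rewrite !summxE; apply: eq_bigr => l _.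
rewrite !mxE; congr (_ * _).
case: (pselect (exists z, S l z z != 0)) => [ex|nex]; last first.
  have S0 z : S l z z = 0.
    by apply/eqP; apply: contra_notT nex => nz; exists z.
  by rewrite !S0.
have /is_diag_mxP dl := hD l ex.
(* Products of members lie in the algebra, hence are symmetric, so members commute. *)
have comm : S l *m const_mx 1 = const_mx 1 *m S l.
  rewrite -hJ mulmx_sumr mulmx_suml; apply: eq_bigr => m _.
  rewrite -[LHS]bose_mesner_sym; last first.
    by apply: bose_mesnerM; exact: bose_mesner_basis.
  by rewrite trmx_mul; case: (hS1 l) => _ -> _; case: (hS1 m) => _ -> _.
move/matrixP/(_ x y): comm; rewrite !mxE.
rewrite (bigD1 x) //= big1 => [|z zx]; last by rewrite dl ?mul0r // eq_sym.
rewrite (bigD1 y) //= big1 => [|z zy]; last by rewrite dl ?mulr0.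
by rewrite !mxE mulr1 mul1r !addr0.
Qed.

(** Since 0/1 matrices summing to the all-ones matrix have disjoint supports, only the coefficient
    of [S i] is seen on the support of [S i]. *)
Lemma bose_mesner_const M i : bose_mesner S M ->
  exists c, forall x y, S i x y = 1 -> M x y = c.
Proof.
case: hS => hS1 hJ _ _ [a ->]; exists (a i) => x y Si1.
rewrite summxE (bigD1 i) //= big1 => [|l li]; first by rewrite mxE Si1 mulr1 addr0.
have /matrixP/(_ x y) := hJ; rewrite summxE mxE (bigD1 i) //= Si1 => /eqP.
rewrite -subr_eq0 addrAC subrr add0r psumr_eq0 => [/allP/(_ l)|m _].
  rewrite mem_index_enum li /= => /(_ isT) /eqP; rewrite mxE => ->.
  by rewrite mulr0.
by case: (hS1 m) => _ _ /(_ x y) [] ->.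
Qed.

End scheme.

(** Some member has a nonzero diagonal entry. It is then a diagonal matrix with constant diagonal
    and 0/1 entries, that is, the identity. *)
Lemma bose_mesner1 n (S : 'I_d.+1 -> 'M[R]_n) :
  assoc_scheme S -> bose_mesner S 1%:M.
Proof.
case: n S => [|n] S hS.
  by rewrite (_ : 1%:M = 0); [exact: bose_mesner0|apply/matrixP => -[]].
have [hS1 hJ hD _] := hS.
have [j Sj] : exists j, S j ord0 ord0 != 0.
  apply/existsP; apply: contraT; rewrite negb_exists => /forallP S0.
  have /matrixP/(_ ord0 ord0) := hJ; rewrite summxE mxE big1 => [/eqP|l _].
    by rewrite eq_sym oner_eq0.
  by apply/eqP; rewrite -[_ == _]negbK S0.
have -> : 1%:M = S j; last exact: bose_mesner_basis.
have /is_diag_mxP dj : is_diag_mx (S j) by apply: hD; exists ord0.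
apply/matrixP => x y; rewrite mxE; case: eqVneq => [->|xy]; last by rewrite dj.
rewrite (bose_mesner_diag hS (bose_mesner_basis S j) y ord0).
by case: (hS1 j) => _ _ /(_ ord0 ord0) [] s0; rewrite s0 ?eqxx // in Sj *.
Qed.

Lemma bose_mesner_horner n (S : 'I_d.+1 -> 'M[R]_n.+1) A p :
  assoc_scheme S -> bose_mesner S A -> bose_mesner S (horner_mx A p).
Proof.
move=> hS hA; elim/poly_ind: p => [|p c IH].
  by rewrite rmorph0; exact: bose_mesner0.
rewrite rmorphD rmorphM /= horner_mx_X horner_mx_C.
apply: bose_mesnerD; first exact: bose_mesnerM.
by rewrite -scalemx1; apply: bose_mesnerZ; exact: bose_mesner1.
Qed.

Lemma bose_mesner_eigen n (S : 'I_d.+1 -> 'M[R]_n) A l :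
  assoc_scheme S -> bose_mesner S A -> eigenvalue A l ->
  exists P, [/\ bose_mesner S P, P != 0 & A *m P = l *: P].
Proof.
case: n S A => [|n] S A hS hA.
  by move=> /eigenvalueP[v _]; rewrite (_ : v = 0) ?eqxx //; apply/matrixP => ? -[].
rewrite eigenvalue_root_min => lroot.
pose p := mxminpoly A %/ ('X - l%:P).
have pE : p * ('X - l%:P) = mxminpoly A by rewrite divpK // dvdp_XsubCl.
exists (horner_mx A p); split; first exact: bose_mesner_horner.
  (* If [p] annihilated [A], the minimal polynomial would divide [p], whose degree is smaller by
     one. *)
  apply/eqP => /mxminpoly_min; rewrite -pE => pdvd.
  have p0 : p != 0.
    by apply: contraTneq (monic_neq0 (mxminpoly_monic A)) => p0; rewrite -pE p0 mul0r eqxx.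
  have := dvdp_leq p0 pdvd; rewrite size_Mmonic ?monicXsubC // size_XsubC.
  by rewrite addn2 ltnn.
apply/eqP; rewrite -subr_eq0; apply/eqP.
have : horner_mx A (('X - l%:P) * p) = 0 by rewrite mulrC pE mx_root_minpoly.
rewrite rmorphM rmorphB /= horner_mx_X horner_mx_C mulrBl => <-.
by rewrite -[l%:M * _]/(l%:M *m _) mul_scalar_mx.
Qed.

End bose_mesner.

(** * Fractional cut covers *)

Section fcc_min.
Variables (R : realType) (V : finType) (G : sgraph V).
Local Open Scope classical_set_scope.

Lemma continuous_lincomb (I : finType) (c : I -> R) :
  continuous (fun y : {ptws I -> R} => \sum_i y i * c i).
Proof.
apply: continuous_big; first exact: add_continuous.
move=> i _ y.
have yi : (fun z : {ptws I -> R} => z i : R) @ y --> (y i : R).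
  exact: (@proj_continuous I (fun=> R) i y).
have FF : Filter (nbhs y) by exact: nbhs_filter.
have yc : (fun z : {ptws I -> R} => c i) @ y --> c i.
  exact: (@cvg_cst _ (c i) _ (nbhs y) FF).
exact: (@cvgM R _ (nbhs y) FF _ _ _ _ yi yc).
Qed.

(** Covers of total at most that of [y0] have all weights in [[0, C]]. They lie in a compact box cut
    by closed constraints, where the continuous total attains its minimum; so [fcc] is not the
    default value 0. *)
Lemma fcc_attained (y0 : {set V} -> R) : fcc_feasible G y0 ->
  is_min [set \sum_(S : {set V}) y S | y in [set y : {set V} -> R |
                                               fcc_feasible G y]] (fcc R G).
Proof.
move=> hy0; pose X := {ptws {set V} -> R}.
pose C := \sum_S y0 S.
pose box : set X := [set y | forall S, `[0, C]%classic (y S)].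
pose F : set X := \bigcap_(p in [set p : V * V | G p.1 p.2])
  [set y | 1 <= \sum_S y S * cut_ind R S p.1 p.2].
have box_compact : compact box.
  exact: (@tychonoff _ (fun=> R) (fun=> `[0, C]%classic) (fun=> @segment_compact _ _ _)).
have F_closed : closed F.
  apply: closed_bigI => p _.
  have cont := @continuous_lincomb _ (fun S : {set V} => cut_ind R S p.1 p.2).
  exact: ((continuous_closedP _).1 cont _ (@closed_ge R 1)).
have K_compact : compact (box `&` F) by exact: compact_closedI.
have inK (y : {set V} -> R) : fcc_feasible G y -> \sum_S y S <= C -> (box `&` F) y.
  move=> [yge yG] yC; split=> [S|[u v]] /=; last exact: yG.
  rewrite in_itv /= yge /=; apply: le_trans yC.
  by rewrite (bigD1 S) //= lerDl sumr_ge0.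
have sum_cont : continuous (fun y : X => \sum_S y S).
  rewrite (_ : (fun _ => _) = (fun y : X => \sum_S y S * (1 : R))).
    exact: (@continuous_lincomb _ (fun=> 1)).
  by apply/funext => y; apply: eq_bigr => S _; rewrite mulr1.
have [|c cK cmin] := @compact_EVT_min X R (fun y => \sum_S y S) _ _ K_compact
    (continuous_subspaceT sum_cont).
  by exists y0; exact: inK.
have [cbox cF] := set_mem cK.
have min : is_min [set \sum_(S : {set V}) y S | y in [set y : {set V} -> R |
                                               fcc_feasible G y]] (\sum_S c S).
  split.
    exists c => //; split=> [S|u v uv]; last exact: (cF (u, v)).
    by have := cbox S; rewrite /= in_itv /= => /andP[].
  move=> _ [y hy <-]; have [yC|/ltW Cy] := lerP (\sum_S y S) C.
    by apply: cmin; apply: mem_set; exact: inK.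
  by apply: le_trans Cy; apply: cmin; apply: mem_set; exact: inK.
by rewrite /fcc (set_min_eq min).
Qed.
End fcc_min.

(** Testing the trace bound on the rank-one matrix [v^T *m v] of an eigenvector [v] shows that no
    eigenvalue is smaller than [l]. *)
Lemma lambda_minP (R : realType) n (A : 'M[R]_n) : (0 < n)%N -> A^T = A ->
  eigenvalue A (lambda_min A) /\
  forall N, psdmx N -> lambda_min A * \tr N <= \tr (A *m N).
Proof.
move=> n0 Asym; have [l lA lpsd] := symmetric_min_eigenvalue n0 Asym.
suff m : is_min [set a : R | eigenvalue A a]%classic l.
  by rewrite /lambda_min (set_min_eq m).
split=> // a /= /eigenvalueP[v vA v0].
have vT (w : 'cV[R]_n) : (w^T *m (v^T *m v) *m w) 0 0 = ((v *m w) 0 0) ^+ 2.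
  have -> : w^T *m (v^T *m v) *m w = (v *m w)^T *m (v *m w).
    by rewrite trmx_mul !mulmxA.
  by rewrite mxE big_ord1 mxE expr2.
have /lpsd : psdmx (v^T *m v).
  by split=> [|w]; [rewrite trmx_mul trmxK|rewrite vT sqr_ge0].
rewrite mulmxA mxtrace_mulC (mxtrace_mulC _ v) mulmxA vA -scalemxAl.
rewrite mxtraceZ ler_pM2r // trace_mx11 mxE lt_neqAle eq_sym.
rewrite sumr_ge0 ?andbT => [|i _]; last by rewrite mxE -expr2 sqr_ge0.
rewrite psumr_neq0 => [|i _]; last by rewrite mxE -expr2 sqr_ge0.
have /rV0Pn[i vi] := v0; apply/hasP; exists i; rewrite ?mem_index_enum //=.
by rewrite mxE -expr2 exprn_even_gt0.
Qed.

(** * Regular graphs in an association scheme *)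

Section regular_scheme.
Variables (R : realType) (V : finType) (G : sgraph V) (k d : nat).
Variable S : 'I_d.+1 -> 'M[R]_#|V|.
Hypothesis hreg : regular G k.
Hypothesis hS : assoc_scheme S.
Hypothesis hA : exists i : 'I_d.+1, adjmx R G = S i.

Let A := adjmx R G.
Let l := lambda_min A.

Lemma adjmx_sym : A^T = A.
Proof. by apply/matrixP => i j; rewrite !mxE adj_sym. Qed.

Lemma adjmx_edge u v : G u v -> A (enum_rank u) (enum_rank v) = 1.
Proof. by move=> uv; rewrite mxE !enum_rankK uv. Qed.

Lemma adjmx_row i : \sum_j A i j = k%:R.
Proof.
rewrite (reindex enum_rank); last exact/onW_bij/enum_rank_bij.
rewrite -(hreg (enum_val i)) -sum1_card natr_sum [RHS]big_mkcond /=.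
apply: eq_bigr => v _.
by rewrite mxE enum_rankK inE; case: (G _ _).
Qed.

(** Members of a scheme are nonzero, which excludes the edgeless graph and hence [k = 0]. *)
Lemma exists_edge : exists u v, G u v.
Proof.
have [i Ai] := hA; have [hS1 _ _ _] := hS.
have [/eqP A0 _ _] := hS1 i; apply: contrapT => nG; apply: A0; rewrite -Ai.
apply/matrixP => x y; rewrite !mxE; case: (boolP (G _ _)) => // xy.
by case: nG; exists (enum_val x), (enum_val y).
Qed.

Lemma card_vertices_gt0 : (0 < #|V|)%N.
Proof. by have [u _] := exists_edge; apply/card_gt0P; exists u. Qed.

Lemma degree_gt0 : 0 < k%:R :> R.
Proof.
have [u [v uv]] := exists_edge; rewrite ltr0n -(hreg u).
by apply/card_gt0P; exists v; rewrite inE.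
Qed.

(** The trace bound is applied to the identity, the trace of [A] being zero. *)
Lemma lambda_min_le0 : l <= 0.
Proof.
have [_ /(_ 1%:M)] := lambda_minP card_vertices_gt0 adjmx_sym.
rewrite mulmx1 mxtrace1 [\tr _]big1 => [|i _]; last by rewrite mxE adj_irr.
move=> /(_ _)/le_trans H.
rewrite -(pmulr_rle0 _ (_ : 0 < #|V|%:R)) ?ltr0n ?card_vertices_gt0 //.
rewrite mulrC; apply: H => //; split=> [|x]; first by rewrite trmx1.
by rewrite mulmx1 mxE sumr_ge0 // => i _; rewrite mxE -expr2 sqr_ge0.
Qed.

Lemma degree_sub_gt0 : 0 < k%:R - l.
Proof. by rewrite subr_gt0 (le_lt_trans lambda_min_le0) ?degree_gt0. Qed.

(** With [n = #|V|], the edge constraints sum to [2 n k <= n k mu - tr (A N)], and the spectral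
    bound is [l n mu <= tr (A N)]; together they give [2 k <= (k - l) mu]. *)
Lemma eta_feasible_ge mu N : eta_feasible G mu N -> 2 * k%:R / (k%:R - l) <= mu.
Proof.
move=> [mu0 [Nsym Npsd] Nd Ne].
have n0 : 0 < #|V|%:R :> R by rewrite ltr0n card_vertices_gt0.
have [_ /(_ N (conj Nsym Npsd))] := lambda_minP card_vertices_gt0 adjmx_sym.
have -> : \tr N = #|V|%:R * mu.
  by rewrite /mxtrace (eq_bigr (fun=> mu)) // sumr_const card_ord mulr_natl.
have -> : \tr (A *m N) = \sum_i \sum_j A i j * N i j.
  apply: eq_bigr => i _; rewrite mxE; apply: eq_bigr => j _.
  by congr (_ * _); rewrite -{1}Nsym mxE.
have sumA : \sum_i \sum_j A i j = #|V|%:R * k%:R.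
  by rewrite (eq_bigr _ (fun i _ => adjmx_row i)) sumr_const card_ord mulr_natl.
have : \sum_i \sum_j A i j <= \sum_i \sum_j A i j * ((mu - N i j) / 2).
  apply: ler_sum => i _; apply: ler_sum => j _; rewrite !mxE.
  case: (boolP (G _ _)) => [/Ne|_]; last by rewrite mul0r.
  by rewrite /Lstar !enum_valK !Nd mul1r /=; lra.
rewrite sumA -/l.
have -> : \sum_i \sum_j A i j * ((mu - N i j) / 2) =
    (#|V|%:R * k%:R * mu - \sum_i \sum_j A i j * N i j) / 2.
  rewrite -sumA !mulr_suml -sumrB mulr_suml; apply: eq_bigr => i _.
  by rewrite !mulr_suml -sumrB mulr_suml; apply: eq_bigr => j _; ring.
move: (\sum_i _) => t h1 h2; rewrite ler_pdivrMr ?degree_sub_gt0 //.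
rewrite -(ler_pM2l n0); lra.
Qed.

(** The rows of [Q] are those of the eigenmatrix [P], normalized by the constant diagonal [e] of
    [P *m P]. They serve both as a feasible matrix for [eta_circ] and as input to the rounding. *)
Lemma exists_unit_gram : exists Q : 'M[R]_#|V|,
  (forall i, \sum_m Q i m * Q i m = 1) /\
  (forall i j, A i j = 1 -> \sum_m Q i m * Q j m = l / k%:R).
Proof.
have [i0 Ai] := hA; have k0 := degree_gt0.
have bA : bose_mesner S A by rewrite /A Ai; exact: bose_mesner_basis.
have [lA _] := lambda_minP card_vertices_gt0 adjmx_sym.
have [P [bP P0 AP]] := bose_mesner_eigen hS bA lA.
have Psym := bose_mesner_sym hS bP.
have bN : bose_mesner S (P *m P) by exact: bose_mesnerM.
have NE i j : (P *m P) i j = \sum_m P i m * P j m.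
  by rewrite mxE; apply: eq_bigr => m _; rewrite -[in X in _ * X]Psym mxE.
have [c cE] := bose_mesner_const hS i0 bN.
have [x [y Pxy]] : exists x y, P x y != 0.
  by have /matrix0Pn := P0.
pose e := (P *m P) x x; have eE i : (P *m P) i i = e by exact: (bose_mesner_diag hS bN i x).
have e0 : 0 < e.
  rewrite /e NE (bigD1 y) //= ltr_pwDl -?expr2 ?exprn_even_gt0 //.
  by rewrite sumr_ge0 // => m _; rewrite -expr2 sqr_ge0.
have kc : k%:R * c = l * e.
  have : (A *m (P *m P)) x x = l * e by rewrite mulmxA AP -scalemxAl mxE.
  rewrite mxE => <-; rewrite -(adjmx_row x) mulr_suml; apply: eq_bigr => j _.
  have [Axj|Axj] : A x j = 0 \/ A x j = 1 by rewrite mxE; case: (G _ _); [right|left].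
    by rewrite Axj !mul0r.
  by rewrite cE // -Ai -[adjmx R G]adjmx_sym mxE.
(* The relation [kc] compares a diagonal entry of [A *m (P *m P)], a sum over the [k] neighbours,
   with that of [l *: (P *m P)]; it yields [c / e = l / k]. *)
pose r := (Num.sqrt e)^-1; have r2 : r * r = e^-1.
  by rewrite /r -invfM -expr2 sqr_sqrtr // ltW.
have QE i j : \sum_m (r *: P) i m * (r *: P) j m = (P *m P) i j / e.
  rewrite NE mulr_suml; apply: eq_bigr => m _; rewrite !mxE -r2; ring.
exists (r *: P); split=> [i|i j Aij]; rewrite QE.
  by rewrite eE divff // gt_eqF.
have kn0 : k%:R != 0 :> R by rewrite gt_eqF.
have en0 : e != 0 by rewrite gt_eqF.
rewrite cE -?Ai // -[c](mulKf kn0) kc; field.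
by rewrite kn0 en0.
Qed.

Lemma eta_circ_regular_scheme : eta_circ R G = 2 * k%:R / (k%:R - l).
Proof.
apply: set_min_eq; split; last by move=> mu [N /eta_feasible_ge].
have [Q [Q1 Qe]] := exists_unit_gram; have k0 := degree_gt0.
have kl := degree_sub_gt0; set mu := 2 * k%:R / (k%:R - l).
have mu0 : 0 <= mu by rewrite divr_ge0 ?mulr_ge0 // ltW.
have QE i j : (Q *m Q^T) i j = \sum_m Q i m * Q j m.
  by rewrite mxE; apply: eq_bigr => m _; rewrite mxE.
(* All edge constraints are tight, because [mu * (1 - l / k) / 2 = 1]. *)
exists (mu *: (Q *m Q^T)); split=> // [|i|u v uv].
- split=> [|x]; first by rewrite linearZ /= trmx_mul trmxK.
  rewrite -scalemxAr -scalemxAl mxE mulr_ge0 //.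
  have -> : x^T *m (Q *m Q^T) *m x = (Q^T *m x)^T *m (Q^T *m x).
    by rewrite trmx_mul trmxK !mulmxA.
  by rewrite mxE sumr_ge0 // => m _; rewrite mxE -expr2 sqr_ge0.
- by rewrite mxE QE Q1 mulr1.
have NE i j : (mu *: (Q *m Q^T)) i j = mu * \sum_m Q i m * Q j m by rewrite mxE QE.
rewrite /Lstar !NE !Q1 Qe ?adjmx_edge // /mu.
have kn0 : k%:R != 0 :> R by rewrite gt_eqF.
have kln0 : k%:R - l != 0 by rewrite gt_eqF.
rewrite le_eqVlt; apply/orP; left; apply/eqP; field.
by rewrite kln0 kn0.
Qed.

Lemma fcc_feasible_ge y : fcc_feasible G y ->
  2 * k%:R / (k%:R - l) <= \sum_(T : {set V}) y T.
Proof.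
move=> [y0 yG]; pose s (T : {set V}) (i : 'I_#|V|) : R := (-1) ^+ (enum_val i \in T).
pose N : 'M[R]_#|V| := \matrix_(i, j) \sum_T y T * (s T i * s T j).
have sE T i : s T i * s T i = 1 by rewrite -expr2 sqrr_sign.
apply: (@eta_feasible_ge _ N); split.
- by rewrite sumr_ge0.
- split=> [|x].
    by apply/matrixP => i j; rewrite !mxE; apply: eq_bigr => T _; rewrite (mulrC (s T i)).
  have -> : (x^T *m N *m x) 0 0 = \sum_T y T * (\sum_i s T i * x i 0) ^+ 2.
    rewrite mxE; under eq_bigr => j _.
      rewrite mxE mulr_suml; under eq_bigr => i _.
        rewrite !mxE mulr_sumr mulr_suml; over.
      over.
    under eq_bigr do rewrite exchange_big /=.
    rewrite exchange_big /=; apply: eq_bigr => T _.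
    rewrite expr2 mulr_suml mulr_sumr exchange_big /=; apply: eq_bigr => i _.
    rewrite !mulr_sumr; apply: eq_bigr => j _; ring.
  by rewrite sumr_ge0 // => T _; rewrite mulr_ge0 // sqr_ge0.
- by move=> i; rewrite mxE; apply: eq_bigr => T _; rewrite sE mulr1.
move=> u v /yG; rewrite /Lstar !mxE => /le_trans; apply.
(* For signs, a quarter of the squared difference is the indicator of the cut. *)
rewrite le_eqVlt; apply/orP; left; apply/eqP.
rewrite -big_split /= mulr_sumr -sumrB mulr_sumr; apply: eq_bigr => T _.
rewrite !sE /s !enum_rankK /cut_ind.
by case: (u \in T); case: (v \in T); rewrite /= ?expr0 ?expr1; field.
Qed.

(** The rounding distribution cuts an edge with probability at least [alphaGW R * (1 - l / k) / 2],
    the inverse of the factor by which it is rescaled. *)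
Lemma exists_fcc_feasible : exists2 y : {set V} -> R, fcc_feasible G y &
  \sum_(T : {set V}) y T = 2 * k%:R / (k%:R - l) / alphaGW R.
Proof.
have [Q [Q1 Qe]] := exists_unit_gram; have k0 := degree_gt0.
have kl := degree_sub_gt0; have al := alphaGW_gt0 R.
(* Rows of [Q] are padded with zeros to length [#|V|.+3], since the rounding takes place in
   dimension at least 3. *)
pose u v m := if insub m is Some j then Q (enum_rank v) j else 0.
have uE v w : \sum_(m < #|V|.+3) u v m * u w m =
    \sum_m Q (enum_rank v) m * Q (enum_rank w) m.
  rewrite [RHS](eq_bigr (fun m : 'I_#|V| => u v m * u w m)); last first.
    by move=> m _; rewrite /u valK.
  have le3 : (#|V| <= #|V|.+3)%N by rewrite !leqW.
  rewrite (big_ord_widen _ (fun m => u v m * u w m) le3) [RHS]big_mkcond.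
  apply: eq_bigr => m _ /=; case: ifPn => // mV.
  by rewrite /u insubN ?mul0r.
have [|p [p0 p1 pcut]] := @hyperplane_rounding R V #|V| u.
  by move=> v; rewrite uE.
set mu := 2 * k%:R / (k%:R - l).
have mu0 : 0 < mu by rewrite divr_gt0 ?mulr_gt0.
exists (fun T => mu / alphaGW R * p T); last by rewrite -mulr_sumr p1 mulr1.
split=> [T|v w vw]; first by rewrite mulr_ge0 // divr_ge0 // ltW.
rewrite (eq_bigr (fun T => mu / alphaGW R * (p T * cut_ind R T v w))); last first.
  by move=> T _; rewrite mulrA.
have [b h] := pcut v w; rewrite -mulr_sumr.
have := ler_wpM2l (ltW (divr_gt0 mu0 al)) (le_trans (alphaGW_le_acos b) h).
rewrite mulrA divfK ?gt_eqF //; apply: le_trans.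
rewrite uE Qe ?adjmx_edge // /mu.
have kn0 : k%:R != 0 :> R by rewrite gt_eqF.
have kln0 : k%:R - l != 0 by rewrite gt_eqF.
rewrite le_eqVlt; apply/orP; left; apply/eqP; field.
by rewrite kln0 kn0.
Qed.

End regular_scheme.

Theorem theorem6 (R : realType) (V : finType) (G : sgraph V) (k d : nat)
    (S : 'I_d.+1 -> 'M[R]_#|V|)
    (hreg : regular G k)
    (hS : assoc_scheme S)
    (hA : exists i : 'I_d.+1, adjmx R G = S i) :
  eta_circ R G = 2 * k%:R / (k%:R - lambda_min (adjmx R G)) /\
  1 <= fcc R G / (2 * k%:R / (k%:R - lambda_min (adjmx R G)))
    <= 1 / alphaGW R.
Proof.
split; first exact: eta_circ_regular_scheme hreg hS hA.
have mu0 : 0 < 2 * k%:R / (k%:R - lambda_min (adjmx R G)).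
  by rewrite divr_gt0 ?mulr_gt0 ?(degree_gt0 hreg hS hA) ?(degree_sub_gt0 hreg hS hA).
have [y yG yE] := exists_fcc_feasible hreg hS hA.
(* The rounded cover [y] guarantees attainment, so [fcc R G] becomes the total of an optimal [z]:
   the first bound applies to [z], the second compares it with [y]. *)
have [[z zG <-] fccmin] := fcc_attained yG.
apply/andP; split; first by rewrite ler_pdivlMr // mul1r (fcc_feasible_ge hreg hS hA).
rewrite ler_pdivrMr // mul1r mulrC -yE.
by apply: fccmin; exists y.
Qed.
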